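(* Let $G=(V,E)$ be a graph. For every hypersphere representation of $G$ with squared radius $t$, every orthonormal representation $p: V\to\mathbb{R}^d$ of $G$, and every unit vector $c\in\mathbb{R}^d$ such that $c\notin p(V)^{\perp}$, we have $$2t + \Big[\sum_{i\in V}(c^{T}p(i))^2\Big]^{-1}\ge 1,$$ with equality if and only if $t=t(G)$ and $\sum_{i\in V}(c^{T}p(i))^2=\vartheta(\overline{G})$.
   Context: Graphs are finite and simple with nonempty vertex set; $\overline{G}$ is the complement of $G$. $\bar e$ is the all-ones vector. $p(V)^\perp$ is the set of vectors orthogonal to all $p(i)$, $i\in V$. A unit-distance representation of $G=(V,E)$ is a function $u: V\to\mathbb{R}^d$ for some $d\ge 1$ with $\|u(i)-u(j)\|=1$ (Euclidean norm) whenever $\{i,j\}\in E$. A hypersphere representation of $G$ is a unit-distance representation of $G$ whose image is contained in a hypersphere centered at the origin (radius $r\ge 0$, radius $0$ allowed); its squared radius is $r^2$. The hypersphere number $t(G)$ is the minimum squared radius of a hypersphere representation of $G$. The theta number of a graph $H=(V,F)$ is $\vartheta(H)=\max\{\bar e^{T}X\bar e : \mathrm{Tr}(X)=1,\ X_{ij}=0\ \forall\{i,j\}\in F,\ X \text{ symmetric positive semidefinite } V\times V\}$. An orthonormal representation of a graph $G=(V,E)$ is a function $p$ from $V$ to the unit sphere in $\mathbb{R}^d$, for some $d\ge1$, mapping distinct non-adjacent nodes of $G$ to orthogonal vectors. *)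

(* Defs.v *)
From mathcomp Require Import all_boot all_order all_algebra.
From mathcomp Require Import boolp classical_sets reals.

Set Implicit Arguments.
Unset Strict Implicit.
Unset Printing Implicit Defensive.
Import Order.TTheory GRing.Theory Num.Theory.
Local Open Scope classical_set_scope.
Local Open Scope ring_scope.

(* A graph is a nonempty finite vertex type [V] with a symmetric, irreflexive
   adjacency relation [E : rel V]. *)
Definition simple_graph (V : finType) (E : rel V) : Prop :=
  [/\ (0 < #|V|)%N, symmetric E & irreflexive E].

Definition compl_graph (V : finType) (E : rel V) : rel V :=
  [rel i j | (i != j) && ~~ E i j].

Definition dotv (R : realType) (d : nat) (x y : 'cV[R]_d) : R :=
  (x^T *m y) 0 0.

(* The Euclidean norm; MathComp-Analysis norms matrices by the sup norm. *)
Definition enorm (R : realType) (d : nat) (x : 'cV[R]_d) : R :=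
  Num.sqrt (dotv x x).

Definition unit_distance_rep (R : realType) (V : finType) (E : rel V)
    (d : nat) (u : V -> 'cV[R]_d) : Prop :=
  (0 < d)%N /\ forall i j, E i j -> enorm (u i - u j) = 1.

(* [t] is the squared radius, determined by [u] because [V] is nonempty. *)
Definition hypersphere_rep (R : realType) (V : finType) (E : rel V)
    (d : nat) (u : V -> 'cV[R]_d) (t : R) : Prop :=
  unit_distance_rep E u /\
  exists r : R, [/\ 0 <= r, t = r ^+ 2 & forall i, enorm (u i) = r].

Definition is_minimum (R : realType) (S : set R) (x : R) : Prop :=
  S x /\ lbound S x.

Definition is_maximum (R : realType) (S : set R) (x : R) : Prop :=
  S x /\ ubound S x.

(* [is_hypersphere_number E t] reads t = t(G). *)
Definition is_hypersphere_number (R : realType) (V : finType) (E : rel V) :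
    R -> Prop :=
  is_minimum [set t | exists (d : nat) (u : V -> 'cV[R]_d),
                        hypersphere_rep E u t].

Definition sym_psd (R : realType) (n : nat) (X : 'M[R]_n) : Prop :=
  X^T = X /\ forall x : 'cV[R]_n, 0 <= (x^T *m X *m x) 0 0.

(* V x V matrices are square matrices of size #|V|, a vertex [i] indexing
   row and column [enum_rank i]. *)
Definition theta_feasible (R : realType) (V : finType) (F : rel V)
    (X : 'M[R]_#|V|) : Prop :=
  [/\ \tr X = 1,
      forall i j : V, F i j -> X (enum_rank i) (enum_rank j) = 0
    & sym_psd X].

Definition ones (R : realType) (n : nat) : 'cV[R]_n := const_mx 1.

(* [is_theta F s] reads s = theta(H), for H the graph with edge relation F. *)
Definition is_theta (R : realType) (V : finType) (F : rel V) : R -> Prop :=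
  is_maximum [set s | exists2 X : 'M[R]_#|V|, theta_feasible F X
                        & s = ((ones R #|V|)^T *m X *m ones R #|V|) 0 0].

Definition orthonormal_rep (R : realType) (V : finType) (E : rel V)
    (d : nat) (p : V -> 'cV[R]_d) : Prop :=
  [/\ (0 < d)%N, forall i, enorm (p i) = 1
    & forall i j, i != j -> ~~ E i j -> dotv (p i) (p j) = 0].

Definition image_perp (R : realType) (V : finType) (d : nat)
    (p : V -> 'cV[R]_d) : set 'cV[R]_d :=
  [set c | forall i, dotv c (p i) = 0].

(* Main.v *)
Require Import Defs.
From mathcomp Require Import all_boot all_order all_algebra.
From mathcomp Require Import boolp classical_sets reals.
From mathcomp Require Import topology normedtype derive ring lra.

Set Implicit Arguments.
Unset Strict Implicit.
Unset Printing Implicit Defensive.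
Import Order.TTheory GRing.Theory Num.Theory.
Import numFieldNormedType.Exports.
Local Open Scope classical_set_scope.
Local Open Scope ring_scope.

(** Write [s] for the sum of the squares of the numbers c.p(i).

    The inequality is weak semidefinite duality.  The vectors (c.p(i)) p(i)
    have a Gram matrix of trace [s] whose entries vanish on non-adjacent pairs,
    so dividing it by [s] gives a matrix [X] feasible for the theta number of
    the complement; by Cauchy-Schwarz against the unit vector [c], its entries
    sum to [v >= s] ([orthonormal_theta_ge]).  On a hypersphere representation
    of squared radius [t], u(i).u(j) is [t] for i = j and t - 1/2 on edges, so
    the inner product of [X] with the Gram matrix of [u] equals
    1/2 + (t - 1/2) v.  An inner product of two positive semidefinite matrices
    is nonnegative, which gives v (1 - 2t) <= 1 ([theta_hypersphere_le]) and
    hence 1 - 2t <= 1/s.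

    If equality holds, these two bounds applied to all hypersphere
    representations (with this [X]) and to all feasible matrices (with this
    [t]) say that [t] is minimal and [s] maximal.

    The converse is strong duality: for [s] the theta number there is a
    hypersphere representation of squared radius (1 - 1/s)/2
    ([theta_hypersphere_exists]), so the minimal [t] is at most that.  Such a
    representation is, up to scaling by 2s, a factorization of a positive
    semidefinite matrix with diagonal s - 1 and entries -1 on the edges.  By
    [psd_completion_alternative], if no such matrix exists then some positive
    semidefinite [D], vanishing on non-adjacent pairs, has s tr D smaller than
    the sum of its entries, and D / tr D contradicts the maximality of [s].
    The alternative itself comes from projecting onto the closed cone of
    positive semidefinite matrices: among them take one closest to the
    prescribed entries; the residual is the matrix [D]. *)

(** * Inner products and norms of vectors *)

Section Dot.
Variable R : realType.

Lemma dotv_ge0 n (x : 'cV[R]_n) : 0 <= dotv x x.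
Proof.
by rewrite /dotv mxE; apply: sumr_ge0 => i _; rewrite mxE -expr2 sqr_ge0.
Qed.

Lemma dotvE n (x y : 'cV[R]_n) : dotv x y = \sum_a x a 0 * y a 0.
Proof. by rewrite /dotv mxE; apply: eq_bigr => a _; rewrite mxE. Qed.

Lemma dotvC n (x y : 'cV[R]_n) : dotv x y = dotv y x.
Proof. by rewrite !dotvE; apply: eq_bigr => a _; rewrite mulrC. Qed.

Lemma dotvDr n (x y z : 'cV[R]_n) : dotv x (y + z) = dotv x y + dotv x z.
Proof. by rewrite /dotv mulmxDr mxE. Qed.

Lemma dotvZr n (x y : 'cV[R]_n) k : dotv x (k *: y) = k * dotv x y.
Proof. by rewrite /dotv -scalemxAr mxE. Qed.

Lemma dotvZl n (x y : 'cV[R]_n) k : dotv (k *: x) y = k * dotv x y.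
Proof. by rewrite dotvC dotvZr dotvC. Qed.

Lemma dotv_sub n (x y : 'cV[R]_n) :
  dotv (x - y) (x - y) = dotv x x + dotv y y - 2 * dotv x y.
Proof.
rewrite -scaleN1r dotvDr dotvC dotvDr [dotv (_ + _) _]dotvC dotvDr.
rewrite !dotvZr !dotvZl (dotvC y x); ring.
Qed.

Lemma enorm_sqr n (x : 'cV[R]_n) : enorm x ^+ 2 = dotv x x.
Proof. by rewrite sqr_sqrtr ?dotv_ge0. Qed.

Lemma dotv_unit_le n (c w : 'cV[R]_n) : enorm c = 1 ->
  dotv c w ^+ 2 <= dotv w w.
Proof.
move=> c1; have cc : dotv c c = 1 by rewrite -enorm_sqr c1 expr1n.
have := dotv_ge0 (w - dotv c w *: c).
rewrite dotv_sub !dotvZr dotvZl cc (dotvC w c); lra.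
Qed.

End Dot.

(** * Positive semidefinite matrices *)

Section Psd.
Variable R : realType.

Definition qform n (M : 'M[R]_n) (x : 'cV[R]_n) : R := (x^T *m M *m x) 0 0.

(** The trace inner product tr(A^T B). *)
Definition pairing n (A B : 'M[R]_n) : R := \sum_i \sum_j A i j * B i j.

Lemma qformE n (M : 'M[R]_n) x : qform M x = pairing M (x *m x^T).
Proof.
rewrite /qform mxE /pairing exchange_big; apply: eq_bigr => j _ /=.
rewrite mxE mulr_suml; apply: eq_bigr => i _.
by rewrite !mxE big_ord1 !mxE; ring.
Qed.

Lemma pairingDr n (A B C : 'M[R]_n) :
  pairing A (B + C) = pairing A B + pairing A C.
Proof.
rewrite /pairing -big_split; apply: eq_bigr => i _ /=.
by rewrite -big_split; apply: eq_bigr => j _; rewrite mxE mulrDr.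
Qed.

Lemma pairingZr n (A B : 'M[R]_n) k : pairing A (k *: B) = k * pairing A B.
Proof.
rewrite /pairing mulr_sumr; apply: eq_bigr => i _ /=.
by rewrite mulr_sumr; apply: eq_bigr => j _; rewrite mxE mulrCA.
Qed.

Lemma pairing_ge0 n (A : 'M[R]_n) : 0 <= pairing A A.
Proof.
by apply: sumr_ge0 => i _; apply: sumr_ge0 => j _; rewrite -expr2 sqr_ge0.
Qed.

Lemma pairing_entry_le n (A : 'M[R]_n) i j : A i j ^+ 2 <= pairing A A.
Proof.
rewrite /pairing (bigD1 i)//= (bigD1 j)//= -addrA -expr2 lerDl.
by rewrite addr_ge0//; do ?[apply: sumr_ge0 => ? _]; rewrite -expr2 sqr_ge0.
Qed.

Lemma qformD n (A B : 'M[R]_n) x : qform (A + B) x = qform A x + qform B x.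
Proof. by rewrite /qform mulmxDr mulmxDl mxE. Qed.

Lemma qformZ n (A : 'M[R]_n) k x : qform (k *: A) x = k * qform A x.
Proof. by rewrite /qform -scalemxAr -scalemxAl mxE. Qed.

Lemma qform_gram m n (B : 'M[R]_(m, n)) x :
  qform (B^T *m B) x = dotv (B *m x) (B *m x).
Proof. by rewrite /qform /dotv trmx_mul !mulmxA. Qed.

Lemma psd_gram m n (B : 'M[R]_(m, n)) : sym_psd (B^T *m B).
Proof.
split=> [|x]; first by rewrite trmx_mul trmxK.
by rewrite -/(qform _ x) qform_gram dotv_ge0.
Qed.

Lemma psdD n (A B : 'M[R]_n) : sym_psd A -> sym_psd B -> sym_psd (A + B).
Proof.
move=> [sA pA] [sB pB]; split=> [|x]; first by rewrite linearD /= sA sB.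
by rewrite -/(qform _ x) qformD addr_ge0 ?pA ?pB.
Qed.

Lemma psdZ n (A : 'M[R]_n) k : 0 <= k -> sym_psd A -> sym_psd (k *: A).
Proof.
move=> k0 [sA pA]; split=> [|x]; first by rewrite linearZ /= sA.
by rewrite -/(qform _ x) qformZ mulr_ge0 ?pA.
Qed.

(** A Gram matrix is a sum of matrices x x^T, against each of which the pairing
    is a value of the quadratic form. *)
Lemma psd_pairing_gram m n (A : 'M[R]_n) (B : 'M[R]_(m, n)) :
  sym_psd A -> 0 <= pairing A (B^T *m B).
Proof.
move=> [_ pA].
have -> : B^T *m B = \sum_k (row k B)^T *m (row k B)^T^T.
  apply/matrixP=> i j; rewrite mxE summxE; apply: eq_bigr => k _.
  by rewrite !mxE big_ord1 !mxE.
elim/big_ind: _ => [|X Y X0 Y0|k _].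
- by rewrite -(scale0r (0 : 'M_n)) pairingZr mul0r.
- by rewrite pairingDr addr_ge0.
- by rewrite -qformE; apply: pA.
Qed.

Lemma addmx11E (A B : 'M[R]_1) : (A + B) 0 0 = A 0 0 + B 0 0.
Proof. by rewrite mxE. Qed.

Lemma scalemx11E k (A : 'M[R]_1) : (k *: A) 0 0 = k * A 0 0.
Proof. by rewrite mxE. Qed.

Lemma qform_delta2 n (M : 'M[R]_n) i j (a b : R) :
  qform M (a *: delta_mx i 0 + b *: delta_mx j 0)
  = a ^+ 2 * M i i + a * b * (M i j + M j i) + b ^+ 2 * M j j.
Proof.
have e k l : ((delta_mx k 0 : 'cV[R]_n)^T *m M
    *m (delta_mx l 0 : 'cV[R]_n)) 0 0 = M k l.
  by rewrite trmx_delta -rowE -colE !mxE.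
rewrite /qform [(_ + _)^T]linearD /= ![(_ *: _)^T]linearZ /=.
rewrite !mulmxDl !mulmxDr -!scalemxAl -!scalemxAr.
by rewrite !scalerA !(addmx11E, scalemx11E) !e; ring.
Qed.

Lemma psd_diag_ge0 n (M : 'M[R]_n) i : sym_psd M -> 0 <= M i i.
Proof.
move=> [_ /(_ (1 *: delta_mx i 0 + 0 *: delta_mx i 0))].
by rewrite -/(qform M _) qform_delta2; lra.
Qed.

(** The quadratic form is nonnegative at e_i + e_j and at e_i - e_j.  This
    controls all entries by the diagonal. *)
Lemma psd_entry_le n (M : 'M[R]_n) i j :
  sym_psd M -> `|M i j| *+ 2 <= M i i + M j j.
Proof.
move=> [sM pM].
have := pM (1 *: delta_mx i 0 + 1 *: delta_mx j 0).
have := pM (1 *: delta_mx i 0 + (- 1) *: delta_mx j 0).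
rewrite -!/(qform M _) !qform_delta2.
have -> : M j i = M i j by rewrite -[in LHS]sM mxE.
move=> h1 h2; rewrite -mulr_natr -ler_pdivlMr ?ltr0n// ler_norml.
by apply/andP; split; lra.
Qed.

Lemma psd_diag0 n (M : 'M[R]_n) : sym_psd M -> (forall i, M i i = 0) -> M = 0.
Proof.
move=> pM M0; apply/matrixP => i j; rewrite mxE.
have := psd_entry_le i j pM; rewrite !M0 addr0 pmulrn_lle0//.
by rewrite normr_le0 => /eqP.
Qed.

Lemma qform_shift n (M : 'M[R]_n) x k i : M^T = M ->
  qform M (x + k *: delta_mx i 0)
  = qform M x + 2 * k * (row i M *m x) 0 0 + k ^+ 2 * M i i.
Proof.
move=> sM.
have e1 : (delta_mx i 0 : 'cV[R]_n)^T *m M = row i M.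
  by rewrite trmx_delta -rowE.
have e2 : x^T *m M *m delta_mx i 0 = row i M *m x.
  apply/matrixP => k' l; rewrite !ord1 -colE !mxE; apply: eq_bigr => j _.
  by rewrite !mxE mulrC -[in LHS]sM mxE.
rewrite /qform [(_ + _)^T]linearD /= [(_ *: _)^T]linearZ /=.
rewrite !mulmxDl !mulmxDr -!scalemxAl -!scalemxAr.
rewrite e1 e2 -colE !(addmx11E, scalemx11E) !mxE; ring.
Qed.

(** One step of symmetric Gaussian elimination.  The new quadratic form at [x]
    is the minimum of the old one on the line through [x] in direction e_i. *)
Lemma psd_pivot n (M : 'M[R]_n) i : sym_psd M -> 0 < M i i ->
  sym_psd (M - (M i i)^-1 *: ((row i M)^T *m row i M)).
Proof.
move=> [sM qM] a0; split=> [|x].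
  by rewrite linearB linearZ /= trmx_mul trmxK sM.
rewrite -scaleNr -/(qform _ x) qformD qformZ qform_gram.
set y := (row i M *m x) 0 0.
have -> : dotv (row i M *m x) (row i M *m x) = y ^+ 2.
  by rewrite /dotv mxE big_ord1 mxE.
have := qM (x + (- (y / M i i)) *: delta_mx i 0).
rewrite -/(qform M _) qform_shift// -/y.
have an : M i i != 0 by rewrite gt_eqF.
have -> : qform M x + 2 * - (y / M i i) * y + (- (y / M i i)) ^+ 2 * M i i
    = qform M x - y ^+ 2 / M i i by field.
by rewrite mulNr [_ / _]mulrC.
Qed.

(** Pivoting on a nonzero diagonal entry makes it zero and keeps the zero ones,
    so finitely many steps reach a matrix with zero diagonal, that is, 0.  Each
    subtracted term is a product x^T x, with x a row vector, and contributes one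
    row to [W]. *)
Lemma psd_factor n (M : 'M[R]_n) : sym_psd M ->
  exists m (W : 'M[R]_(m, n)), (0 < m)%N /\ M = W^T *m W.
Proof.
have [k] := ubnP #|[pred i | M i i != 0]|; elim: k M => // k IH M.
rewrite ltnS => le_k pM.
have [M0|/existsNP[i /eqP Mi]] := pselect (forall i, M i i = 0).
  (* One zero row rather than none, because the height must be positive. *)
  exists 1%N, 0; split=> //.
  by rewrite mulmx0; exact: psd_diag0.
have a0 : 0 < M i i by rewrite lt0r Mi psd_diag_ge0.
have pM' := psd_pivot pM a0.
set M' := M - _ in pM'.
have M'E j : M' j j = M j j - (M i i)^-1 * M i j ^+ 2.
  by rewrite !mxE big_ord1 !mxE -expr2.
have [|m [W [m0 M'W]]] := IH M' _ pM'.
  apply: leq_trans le_k; apply: proper_card; apply/properP; split.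
    apply/fintype.subsetP => j; rewrite !inE; apply: contraNN => /eqP Mj.
    have := psd_diag_ge0 j pM'; rewrite M'E Mj sub0r => h.
    rewrite eq_le oppr_le0; apply/andP; split=> //.
    by rewrite mulr_ge0 ?invr_ge0 ?sqr_ge0// ltW.
  by exists i; rewrite !inE// M'E negbK expr2 mulKf// subrr.
exists (m + 1)%N, (col_mx W ((Num.sqrt (M i i))^-1 *: row i M)).
split; first by rewrite addn1.
rewrite tr_col_mx mul_row_col -M'W [(_ *: _)^T]linearZ /=.
by rewrite -scalemxAl -scalemxAr scalerA -invfM -expr2 sqr_sqrtr ?ltW// subrK.
Qed.

(** * Completion of partial positive semidefinite matrices *)

(** The first-order condition at an endpoint of a segment. *)
Lemma quadratic_ge0_slope (a b : R) : 0 <= b ->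
  (forall e, 0 < e <= 1 -> 0 <= 2 * e * a + e ^+ 2 * b) -> 0 <= a.
Proof.
move=> b0 h; rewrite leNgt; apply/negP => a0.
have ba : 0 < b - a by lra.
have ban : b - a != 0 by rewrite gt_eqF.
(* At this parameter the quadratic equals e a (1 + e), which is negative. *)
have e0 : 0 < - a / (b - a) by rewrite divr_gt0// oppr_gt0.
have /h : 0 < - a / (b - a) <= 1.
  by rewrite e0 /= ler_pdivrMr//; lra.
move: e0; set e := - a / (b - a) => e0.
have eb : e * (b - a) = - a by rewrite mulfVK.
have -> : 2 * e * a + e ^+ 2 * b = (1 + e) * (e * a) by nra.
by rewrite pmulr_rge0 ?pmulr_rge0//; lra.
Qed.

Definition masked n (S : rel 'I_n) (A : 'M[R]_n) : 'M[R]_n :=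
  \matrix_(i, j) if S i j then A i j else 0.

(** The squared distance from [M] to the matrices that agree with [C] on [S]. *)
Definition misfit n (S : rel 'I_n) (C M : 'M[R]_n) : R :=
  pairing (masked S (M - C)) (masked S (M - C)).

Lemma misfitD n (S : rel 'I_n) (C M N : 'M[R]_n) e :
  misfit S C (M + e *: N) = misfit S C M
    + (2 * e * pairing (masked S (M - C)) N
       + e ^+ 2 * pairing (masked S N) (masked S N)).
Proof.
rewrite /misfit /pairing !mulr_sumr -!big_split; apply: eq_bigr => i _ /=.
rewrite !mulr_sumr -!big_split; apply: eq_bigr => j _ /=.
by rewrite !mxE; case: ifP => _; ring.
Qed.

(** The minimization of the misfit takes place in a space of row vectors, where
    closed bounded sets are compact; [vec_mx] reshapes these into matrices. *)
Lemma vec_mx_entry_continuous n i j :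
  continuous (fun v : 'rV[R]_(n * n) => vec_mx v i j).
Proof.
rewrite (_ : (fun _ => _) = fun v : 'rV_(n * n) => v 0 (mxvec_index i j)).
  exact: coord_continuous.
by apply/funext => v; rewrite mxE.
Qed.

Lemma pairing_continuous (T : topologicalType) n (A B : T -> 'M[R]_n) :
  (forall i j, continuous (fun x => A x i j)) ->
  (forall i j, continuous (fun x => B x i j)) ->
  continuous (fun x => pairing (A x) (B x)).
Proof.
move=> cA cB; rewrite /pairing.
apply: continuous_big => [|i _]; first exact: add_continuous.
apply: continuous_big => [|j _]; first exact: add_continuous.
by move=> x; apply: cvgM; [apply: cA | apply: cB].
Qed.

Lemma sub_fun_continuous (T : topologicalType) (f g : T -> R) :
  continuous f -> continuous g -> continuous (fun x => f x - g x).
Proof. by move=> cf cg x; apply: cvgB; [exact: cf | exact: cg]. Qed.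

Lemma misfit_continuous n (S : rel 'I_n) (C : 'M[R]_n) :
  continuous (fun v : 'rV[R]_(n * n) => misfit S C (vec_mx v)).
Proof.
suff c i j : continuous (fun v : 'rV[R]_(n * n) => masked S (vec_mx v - C) i j).
  exact: pairing_continuous.
rewrite (_ : (fun _ => _)
           = fun v => if S i j then vec_mx v i j - C i j else 0 :> R); last first.
  by apply/funext => v; rewrite mxE; case: ifP => // _; rewrite !mxE.
case: (S i j); last by move=> v; apply: cst_continuous.
apply: sub_fun_continuous; first exact: vec_mx_entry_continuous.
by move=> v; apply: cst_continuous.
Qed.

Lemma qform_continuous n (x : 'cV[R]_n) :
  continuous (fun v : 'rV[R]_(n * n) => qform (vec_mx v) x).
Proof.
rewrite (_ : (fun _ => _)
           = fun v : 'rV_(n * n) => pairing (vec_mx v) (x *m x^T)); last first.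
  by apply/funext => v; rewrite qformE.
apply: pairing_continuous => i j; first exact: vec_mx_entry_continuous.
by move=> v; apply: cst_continuous.
Qed.

Lemma closed_psd n : closed [set v : 'rV[R]_(n * n) | sym_psd (vec_mx v)].
Proof.
rewrite (_ : mkset _ =
    \bigcap_(ij in [set: 'I_n * 'I_n])
      [set v | vec_mx v ij.1 ij.2 - vec_mx v ij.2 ij.1 = 0]
    `&` \bigcap_(x in [set: 'cV_n]) [set v | 0 <= qform (vec_mx v) x]).
  apply: closedI; apply: closed_bigI; [move=> [i j] _ /=|move=> x _].
    apply: (@preimage_closed _ _
      (fun v : 'rV_(n * n) => vec_mx v i j - vec_mx v j i) [set y | y = 0]);
      last exact: closed_eq.
    by move=> v _; apply: sub_fun_continuous; exact: vec_mx_entry_continuous.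
  apply: (@preimage_closed _ _ (fun v : 'rV_(n * n) => qform (vec_mx v) x)
      [set y | 0 <= y]); last exact: closed_ge.
  by move=> v _; exact: qform_continuous.
apply/seteqP; split=> v /= [sv qv]; split=> //.
- by move=> [i j] _ /=; apply/eqP; rewrite subr_eq0 -[in X in X == _]sv mxE.
- by move=> x _; exact: qv.
- apply/matrixP => i j; rewrite [LHS]mxE; apply/eqP.
  by rewrite -subr_eq0; apply/eqP; exact: (sv (j, i)).
- by move=> x; exact: qv.
Qed.

(** The misfit bounds the diagonal, because [S] is reflexive, and the diagonal
    of a positive semidefinite matrix bounds its other entries. *)
Lemma misfit_psd_bounded n (S : rel 'I_n) (C : 'M[R]_n) (b : R) :
  reflexive S -> bounded_set
    [set v : 'rV[R]_(n * n) | sym_psd (vec_mx v) /\ misfit S C (vec_mx v) <= b].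
Proof.
move=> rS; exists (b + 1 + \sum_i `|C i i|); split; first exact: num_real.
move=> B ltB v [pv fv].
have diag i : vec_mx v i i <= B.
  have h : (vec_mx v i i - C i i) ^+ 2 <= b.
    apply: le_trans fv; have := pairing_entry_le (masked S (vec_mx v - C)) i i.
    by rewrite mxE rS !mxE.
  have Ci : C i i <= \sum_i `|C i i|.
    by rewrite (bigD1 i)//= (le_trans (ler_norm _))// lerDl sumr_ge0.
  set z := vec_mx v i i - C i i in h.
  (* So the diagonal entry exceeds C i i by at most b + 1. *)
  have : z <= z ^+ 2 + 1 by nra.
  by rewrite /z in h *; lra.
have B0 : 0 <= B.
  have b0 := le_trans (pairing_ge0 _) fv.
  have : 0 <= \sum_i `|C i i| by exact: sumr_ge0.
  lra.
rewrite /= /Num.norm /= mx_normrE; apply/bigmax_leP; split=> // -[i k] _ /=.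
rewrite ord1; case/mxvec_indexP: k => k l.
have -> : v 0 (mxvec_index k l) = vec_mx v k l by rewrite mxE.
have := psd_entry_le k l pv; have := diag k; have := diag l.
rewrite -mulr_natr; lra.
Qed.

(** Only the matrices that do as well as 0 compete, and they form a compact
    set. *)
Lemma misfit_min n (S : rel 'I_n) (C : 'M[R]_n) : reflexive S ->
  exists2 M, sym_psd M & forall N, sym_psd N -> misfit S C M <= misfit S C N.
Proof.
move=> rS; set b := misfit S C 0.
set K := [set v : 'rV[R]_(n * n) |
  sym_psd (vec_mx v) /\ misfit S C (vec_mx v) <= b].
have psd0 : sym_psd (0 : 'M[R]_n).
  by split=> [|x]; rewrite ?trmx0// mulmx0 mul0mx mxE.
have K0 : K !=set0 by exists 0; rewrite /K /= linear0; split.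
have cK : compact K.
  apply: bounded_closed_compact; first exact: misfit_psd_bounded.
  apply: closedI; first exact: closed_psd.
  apply: (@preimage_closed _ _ (fun v : 'rV_(n * n) => misfit S C (vec_mx v))
      [set y | y <= b]); last exact: closed_le.
  by move=> v _; exact: misfit_continuous.
have [|v /set_mem[pv fv] minv] :=
    @compact_EVT_min _ _ (fun v => misfit S C (vec_mx v)) _ K0 cK.
  by apply: continuous_subspaceT; exact: misfit_continuous.
exists (vec_mx v) => // N pN.
have [fN|/ltW fN] := leP (misfit S C N) b; last exact: le_trans fN.
by rewrite -(mxvecK N); apply: minv; rewrite inE /K /= mxvecK.
Qed.

(** A theorem of alternatives: the partial matrix given by [C] on [S] extends to
    a positive semidefinite one unless a positive semidefinite [D] supported on
    [S] separates it from the cone.  For [M] of least misfit take for [D] the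
    masked residual.  Moving from [M] in a direction x x^T shows that [D] is
    positive semidefinite, and shrinking [M] shows that [D] pairs nonpositively
    with [M]; so its pairing with [C] is at most minus its squared norm. *)
Lemma psd_completion_alternative n (S : rel 'I_n) (C : 'M[R]_n) :
  reflexive S -> symmetric S -> C^T = C ->
  (exists2 M, sym_psd M & forall i j, S i j -> M i j = C i j) \/
  exists D, [/\ sym_psd D, forall i j, ~~ S i j -> D i j = 0 & pairing D C < 0].
Proof.
move=> rS yS sC.
have [M pM minM] := misfit_min C rS.
set D := masked S (M - C).
have slope N : (forall e, 0 < e <= 1 -> sym_psd (M + e *: N)) ->
    0 <= pairing D N.
  move=> h; apply: quadratic_ge0_slope (pairing_ge0 (masked S N)) _ => e e01.
  by have := minM _ (h e e01); rewrite misfitD lerDl.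
have sD : D^T = D.
  apply/matrixP => i j; rewrite !mxE yS.
  by rewrite -[in LHS]sC -[in LHS](proj1 pM) !mxE.
have pD : sym_psd D.
  split=> // x; rewrite -/(qform D x) qformE.
  apply: slope => e /andP[e0 _]; apply: psdD => //; apply: psdZ; first exact: ltW.
  by rewrite -{1}(trmxK x); exact: psd_gram.
have DM : pairing D M <= 0.
  have : 0 <= pairing D ((-1) *: M).
    apply: slope => e /andP[e0 e1].
    rewrite scalerA -[X in X + _]scale1r -scalerDl; apply: psdZ => //; lra.
  by rewrite pairingZr; lra.
have DC : pairing D C = pairing D M - misfit S C M.
  rewrite /misfit -/D (_ : pairing D D = pairing D (M + (-1) *: C)).
    by rewrite pairingDr pairingZr; lra.
  apply: eq_bigr => i _; apply: eq_bigr => j _.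
  by rewrite !mxE; case: ifP => _; rewrite ?mul0r// mulN1r.
have [D0|Dn0] := eqVneq D 0.
  left; exists M => // i j Sij; apply/eqP; rewrite -subr_eq0; apply/eqP.
  by have /matrixP/(_ i j) := D0; rewrite !mxE Sij.
right; exists D; split=> // [i j /negbTE Sij|]; first by rewrite mxE Sij.
rewrite DC; suff : 0 < pairing D D by rewrite /misfit -/D; lra.
rewrite lt0r pairing_ge0 andbT; apply: contraNneq Dn0 => DD.
apply/eqP/matrixP => i j; rewrite [RHS]mxE.
by apply/eqP; rewrite -sqrf_eq0 eq_le sqr_ge0 -DD pairing_entry_le.
Qed.

End Psd.

(** * Theta number and hypersphere representations *)

Section Graph.
Variable R : realType.

Definition col_family m n (f : 'I_n -> 'cV[R]_m) : 'M[R]_(m, n) :=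
  \matrix_(a, k) f k a 0.

Lemma gram_col_family m n (f : 'I_n -> 'cV[R]_m) k l :
  ((col_family f)^T *m col_family f) k l = dotv (f k) (f l).
Proof. by rewrite dotvE mxE; apply: eq_bigr => a _; rewrite !mxE. Qed.

Lemma qform_ones n (X : 'M[R]_n) : qform X (ones R n) = \sum_k \sum_l X k l.
Proof.
rewrite qformE; apply: eq_bigr => k _; apply: eq_bigr => l _.
by rewrite !mxE big_ord1 !mxE !mulr1.
Qed.

Lemma pairing_shifted_scalar n (X : 'M[R]_n) a b :
  pairing X (a%:M + b *: const_mx 1) = a * \tr X + b * qform X (ones R n).
Proof.
rewrite qform_ones /mxtrace !mulr_sumr -big_split; apply: eq_bigr => k _ /=.
rewrite mulr_sumr (bigD1 k)//= [in RHS](bigD1 k)//= !mxE eqxx mulr1n.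
rewrite (eq_bigr (fun l => b * X k l)); first by ring.
by move=> l lk; rewrite !mxE eq_sym (negbTE lk) mulr0n; ring.
Qed.

Variables (V : finType) (E : rel V).

Lemma hypersphere_dotv m (u : V -> 'cV[R]_m) t : hypersphere_rep E u t ->
  (forall i, dotv (u i) (u i) = t) /\
  (forall i j, E i j -> dotv (u i) (u j) = t - 2^-1).
Proof.
move=> [[_ u1] [r [_ tr ur]]].
have ut i : dotv (u i) (u i) = t by rewrite -enorm_sqr ur tr.
split=> // i j /u1 uij.
by have := enorm_sqr (u i - u j); rewrite uij dotv_sub !ut; lra.
Qed.

(** Pairing the Gram matrix of [u] with [X] sees only the diagonal and the
    edges, where that Gram matrix agrees with 1/2 I + (t - 1/2) J, J all-ones. *)
Lemma theta_hypersphere_le m (u : V -> 'cV[R]_m) t X :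
  hypersphere_rep E u t -> theta_feasible (compl_graph E) X ->
  qform X (ones R _) * (1 - 2 * t) <= 1.
Proof.
move=> /hypersphere_dotv[ut uE] [trX X0 pX].
set U := col_family (fun k : 'I_#|V| => u (enum_val k)).
have := psd_pairing_gram U pX.
have -> : pairing X (U^T *m U)
    = pairing X ((2^-1)%:M + (t - 2^-1) *: const_mx 1).
  apply: eq_bigr => k _; apply: eq_bigr => l _.
  rewrite gram_col_family !mxE mulr1.
  have [->|kl] := eqVneq k l; first by rewrite ut mulr1n; ring.
  rewrite mulr0n add0r.
  have [Ekl|nE] := boolP (E (enum_val k) (enum_val l)); first by rewrite uE.
  have -> : X k l = 0; last by rewrite !mul0r.
  rewrite -(enum_valK k) -(enum_valK l); apply: X0.
  by apply/andP; split; rewrite ?(inj_eq enum_val_inj)//.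
by rewrite pairing_shifted_scalar trX; lra.
Qed.

Lemma sum_enum_val (F : V -> R) :
  \sum_(i : V) F i = \sum_(k < #|V|) F (enum_val k).
Proof. by rewrite (reindex _ (onW_bij _ (@enum_val_bij V))). Qed.

(** The witness is the Gram matrix of the vectors (c.p(i)) p(i), divided by [s].
    The inner product of [c] with the sum of these vectors is [s], so the
    squared length of that sum is at least the square of [s]. *)
Lemma orthonormal_theta_ge d (p : V -> 'cV[R]_d) c :
  orthonormal_rep E p -> enorm c = 1 ->
  let s := \sum_i dotv c (p i) ^+ 2 in 0 < s ->
  exists2 X, theta_feasible (compl_graph E) X & s <= qform X (ones R _).
Proof.
move=> [_ p1 pE] c1 s s0.
set B := col_family (fun k : 'I_#|V| =>
  dotv c (p (enum_val k)) *: p (enum_val k)).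
have sE : s = \sum_(k < #|V|) dotv c (p (enum_val k)) ^+ 2.
  exact: sum_enum_val.
exists (s^-1 *: (B^T *m B)).
  split; last by apply: psdZ; [rewrite invr_ge0 ltW | exact: psd_gram].
    rewrite linearZ /= (_ : \tr _ = s) ?mulVf ?gt_eqF// sE.
    apply: eq_bigr => k _; rewrite gram_col_family dotvZr dotvZl -enorm_sqr p1.
    by rewrite expr1n mulr1.
  move=> i j /andP[ij nE]; rewrite mxE gram_col_family !enum_rankK dotvZr dotvZl.
  by rewrite pE// !mulr0.
rewrite qformZ qform_gram ler_pdivlMl//.
apply: le_trans (dotv_unit_le _ c1).
rewrite (_ : dotv c _ = s) ?expr2// sE /dotv mulmxA mxE.
apply: eq_bigr => k _; rewrite [ones _ _ _ _]mxE mulr1.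
have -> : (c^T *m B) 0 k = dotv c (dotv c (p (enum_val k)) *: p (enum_val k)).
  by rewrite dotvE mxE; apply: eq_bigr => a _; rewrite !mxE.
by rewrite dotvZr expr2.
Qed.

(** The dual problem asks for a positive semidefinite matrix that agrees with
    s I - J (J all-ones) on the diagonal and the edges.  A matrix [D] that
    obstructs its existence would, once divided by its trace, be feasible for
    the theta number with a value above [s]. *)
Lemma theta_hypersphere_exists s : simple_graph E -> 0 < s ->
  is_theta (compl_graph E) s ->
  exists d (u : V -> 'cV[R]_d), hypersphere_rep E u ((1 - s^-1) / 2).
Proof.
move=> [V0 symE irrE] s0 [_ maxs].
pose S (k l : 'I_#|V|) := (k == l) || E (enum_val k) (enum_val l).
set C : 'M[R]_#|V| := s%:M + (- 1) *: const_mx 1.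
have [||||] := @psd_completion_alternative R _ S C.
- by move=> k; rewrite /S eqxx.
- by move=> k l; rewrite /S eq_sym symE.
- by apply/matrixP => k l; rewrite !mxE eq_sym.
- move=> [M pM MC].
  have [d [W [d0 MW]]] := psd_factor pM.
  pose w (i : V) : 'cV[R]_d := col (enum_rank i) W.
  have wE i j : dotv (w i) (w j) = M (enum_rank i) (enum_rank j).
    by rewrite MW dotvE mxE; apply: eq_bigr => a _; rewrite !mxE.
  have ww i : dotv (w i) (w i) = s - 1.
    by rewrite wE MC /S ?eqxx// !mxE eqxx mulr1n; ring.
  have wEij i j : E i j -> dotv (w i) (w j) = - 1.
    move=> Eij; rewrite wE MC /S ?enum_rankK ?Eij ?orbT// !mxE.
    rewrite (inj_eq enum_rank_inj); case: eqP => [ij|_]; last by rewrite mulr0n; ring.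
    by rewrite ij irrE in Eij.
  (* Vectors with w.w = s - 1, and -1 on edges, are at squared distance 2s. *)
  pose k := (Num.sqrt (2 * s))^-1.
  have kk : k * k = (2 * s)^-1.
    by rewrite -invfM -expr2 sqr_sqrtr// ltW// mulr_gt0.
  have sn0 : s != 0 by rewrite gt_eqF.
  have uu i : dotv (k *: w i) (k *: w i) = (1 - s^-1) / 2.
    by rewrite dotvZr dotvZl mulrA kk ww; field.
  have /card_gt0P[i0 _] := V0.
  exists d, (fun i => k *: w i); split; first split=> // i j Eij.
    rewrite /enorm dotv_sub !uu dotvZr dotvZl [k * (k * _)]mulrA kk wEij//.
    by rewrite -[RHS]sqrtr1; congr Num.sqrt; field.
  exists (Num.sqrt ((1 - s^-1) / 2)); split; first exact: sqrtr_ge0.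
    by rewrite sqr_sqrtr// -(uu i0) dotv_ge0.
  by move=> i; rewrite /enorm uu.
- move=> [D [pD D0]]; rewrite pairing_shifted_scalar => DC.
  have tr0 : 0 <= \tr D by apply: sumr_ge0 => k _; exact: psd_diag_ge0.
  have trn0 : \tr D != 0.
    apply: contraTneq DC => trD0.
    have diag0 k : D k k = 0.
      by apply: (psumr_eq0P _ trD0) => // l _; exact: psd_diag_ge0.
    rewrite (psd_diag0 pD diag0) qform_ones.
    rewrite linear0 mulr0 add0r big1 ?mulr0 ?ltxx// => k _.
    by rewrite big1// => l _; rewrite mxE.
  have trp : 0 < \tr D by rewrite lt0r trn0.
  suff /maxs : exists2 X, theta_feasible (compl_graph E) X
      & (\tr D)^-1 * qform D (ones R _) = qform X (ones R _).
    by rewrite ler_pdivrMl//; lra.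
  exists ((\tr D)^-1 *: D); last by rewrite -qformZ.
  split; last by apply: psdZ => //; rewrite invr_ge0.
    by rewrite linearZ /= mulVf.
  move=> i j /andP[ij nE]; rewrite mxE D0 ?mulr0// /S !enum_rankK.
  by rewrite (inj_eq enum_rank_inj) (negbTE ij).
Qed.

End Graph.

Theorem corollary3p3 (R : realType) (V : finType) (E : rel V)
    (hG : simple_graph E)
    (m : nat) (u : V -> 'cV[R]_m) (t : R) (hu : hypersphere_rep E u t)
    (d : nat) (p : V -> 'cV[R]_d) (hp : orthonormal_rep E p)
    (c : 'cV[R]_d) (hc1 : enorm c = 1) (hc : ~ image_perp p c) :
  2 * t + (\sum_(i : V) (dotv c (p i)) ^+ 2)^-1 >= 1 /\
  (2 * t + (\sum_(i : V) (dotv c (p i)) ^+ 2)^-1 = 1 <->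
   is_hypersphere_number E t /\
   is_theta (compl_graph E) (\sum_(i : V) (dotv c (p i)) ^+ 2)).
Proof.
set s := \sum_(i : V) _.
have s0 : 0 < s.
  rewrite lt0r sumr_ge0 ?andbT => [|i _]; last exact: sqr_ge0.
  apply/negP => /eqP s0; apply: hc => i; apply/eqP; rewrite -sqrf_eq0; apply/eqP.
  by apply: (psumr_eq0P _ s0) => // j _; exact: sqr_ge0.
have sn0 : s != 0 by rewrite gt_eqF.
have [X fX sX] := orthonormal_theta_ge hp hc1 s0.
have bound m' (u' : V -> 'cV[R]_m') t' :
    hypersphere_rep E u' t' -> 1 <= 2 * t' + s^-1.
  move=> /theta_hypersphere_le/(_ fX) h.
  (* Replacing v by the smaller s in v (1 - 2t') <= 1 needs 0 < 1 - 2t'. *)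
  have [t0|t0] := leP (1 - 2 * t') 0; first by have := invr_gt0 s; lra.
  have : 1 - 2 * t' <= s^-1; last by lra.
  rewrite -[s^-1]mul1r ler_pdivlMr// mulrC; apply: le_trans h.
  by rewrite ler_wpM2r// ltW.
split; first exact: bound hu.
split=> [ts|[[_ mint] maxs]].
  split; first split; first by exists m, u.
    by move=> t' [m' [u' /bound]]; lra.
  have ub Y : theta_feasible (compl_graph E) Y ->
      qform Y (ones R _) <= s.
    move=> /(theta_hypersphere_le hu).
    by rewrite (_ : 1 - 2 * t = s^-1) ?ler_pdivrMr ?mul1r//; lra.
  split; last by move=> _ [Y fY ->]; exact: ub.
  by exists X => //; apply/eqP; rewrite eq_le; apply/andP; split; last exact: ub.
apply/eqP; rewrite eq_le (bound _ _ _ hu) andbT.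
have /mint : [set t | exists d (u : V -> 'cV[R]_d), hypersphere_rep E u t]
    ((1 - s^-1) / 2) by exact: theta_hypersphere_exists hG s0 maxs.
lra.
Qed.
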